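(* Let $[a,b]\subset\mathbb{R}$ be a compact interval. For all integers $n,d>0$ and $p\ge0$ consider the family $$\mathcal{F}^{(2)}_{n,p,d}=\Big\{f\in\mathcal{PD}(\mathfrak{D},p):\ \mathfrak{D}=\sum_{j=0}^{n}p_j(x)\partial^j,\ \alpha(\mathfrak{D})=d,\ \deg p_n<p+2\Big\}$$ (the union over all such operators $\mathfrak{D}$ of order $n$ with real polynomial coefficients). Then $$\sigma\big(\mathcal{F}^{(2)}_{n,p,d}\big)\le(p+2)n+d-1.$$
   Context: $[a,b]$ is fixed. $\partial=d/dx$. For $\mathfrak{D}=\sum_{j=0}^np_j(x)\partial^j$ of order $n$ (i.e. $p_n\not\equiv0$) with real polynomial coefficients, let $d_j=\deg p_j$ ($-\infty$ if $p_j\equiv0$), $\alpha_j=d_j-j$, and $\alpha(\mathfrak{D})=\max_{0\le j\le n}\alpha_j$. Class $\mathcal{PD}(\mathfrak{D},p)$: bounded piecewise-continuous functions $f:[a,b]\to\mathbb{R}$ with points of discontinuity of the first kind (jumps) $a=\xi_0<\xi_1<\dots<\xi_p<\xi_{p+1}=b$ (depending on $f$), such that on each continuity interval $[\xi_j,\xi_{j+1}]$ $f$ (with one-sided limits as endpoint values) is $n$ times continuously differentiable ($n$ the order of $\mathfrak{D}$) and satisfies $\mathfrak{D}f=0$. With the convention $f(a^-)=f(b^+)=0$ (i.e. $f$ is extended by zero outside $[a,b]$), the endpoints are also counted as points of discontinuity, so that $f(\xi_j^+)\ne f(\xi_j^-)$ for every $j=0,\dots,p+1$. Values at the $\xi_j$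 are immaterial: $f\equiv0$ means $f$ vanishes off the $\xi_j$. Moments: $m_k(f)=\int_a^b x^kf(x)\,dx$, $k=0,1,2,\dots$. Moment vanishing index: $$\sigma(\mathfrak{D},p)=\sup_{f\in\mathcal{PD}(\mathfrak{D},p),\ f\not\equiv0}\{k:\ m_0(f)=\dots=m_k(f)=0\}+1,$$ with $\sigma(\mathfrak{D},p)=0$ if there are no such $f$ and $k\ge0$. For a family $\mathcal{F}$ of functions, $\sigma(\mathcal{F})=\sup\{\sigma(\mathfrak{D},p'):\ \mathcal{PD}(\mathfrak{D},p')\subset\mathcal{F}\}$. *)

(* Defs.v *)
From HB Require Import structures.
From mathcomp Require Import all_boot all_order all_algebra.
From mathcomp Require Import all_classical all_reals all_analysis.

Set Implicit Arguments.
Unset Strict Implicit.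
Unset Printing Implicit Defensive.

Import Order.TTheory GRing.Theory Num.Theory.
Import numFieldNormedType.Exports.

Local Open Scope classical_set_scope.
Local Open Scope ring_scope.

(* Differential operators sum_(j <= n) p_j(x) (d/dx)^j of order exactly n. *)
Record diffop (R : realType) (n : nat) := DiffOp {
  dcoef : 'I_n.+1 -> {poly R};
  _ : dcoef ord_max != 0
}.

(* The degree, with the convention deg 0 = -oo. *)
Definition edeg (R : realType) (q : {poly R}) : \bar int :=
  if q == 0 then -oo%E else ((size q).-1%:Z)%:E.

Definition alpha (R : realType) (n : nat) (D : diffop R n) : \bar int :=
  \big[maxe/-oo%E]_(j < n.+1) (edeg (dcoef D j) - (j%:Z)%:E)%E.

(* Derivative relative to a set A: on a closed interval this is the one-sided
   derivative at the endpoints and the usual derivative in the interior. The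
   value is meaningful only under derivable_rel. *)
Definition diffq_rel (R : realType) (g : R -> R) (x y : R) : R :=
  (g y - g x) / (y - x).

Definition derivable_rel (R : realType) (A : set R) (g : R -> R) (x : R) : Prop :=
  cvg (diffq_rel g x y @[y --> within A x^']).

Definition derive_rel (R : realType) (A : set R) (g : R -> R) (x : R) : R :=
  lim (diffq_rel g x y @[y --> within A x^']).

Definition deriven_rel (R : realType) (k : nat) (A : set R) (g : R -> R) : R -> R :=
  iter k (derive_rel A) g.

(* g is n times continuously differentiable on A. *)
Definition Cn_on (R : realType) (n : nat) (A : set R) (g : R -> R) : Prop :=
  (forall k : nat, (k < n)%N ->
     forall x, A x -> derivable_rel A (deriven_rel k A g) x) /\
  (forall k : nat, (k <= n)%N -> {within A, continuous (deriven_rel k A g)}).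

Definition apply_diffop (R : realType) (n : nat) (D : diffop R n) (A : set R)
    (g : R -> R) (x : R) : R :=
  \sum_(j < n.+1) (dcoef D j).[x] * deriven_rel j A g x.

(* f restricted to [a, b] is in the class PD(D, p), with jump points
   xi 0 < ... < xi p.+1; the other values of the sequence xi are irrelevant,
   and so are the values of f outside [a, b].
   In the clause on pieces, the continuity of g on the closed interval forces
   its endpoint values to be the one-sided limits of f; in particular the
   limits in the last clause exist. *)
Definition PD_at (R : realType) (a b : R) (n : nat) (D : diffop R n) (p : nat)
    (xi : nat -> R) (f : R -> R) : Prop :=
  let f0 := patch (fun=> 0) `[a, b] f in
  [/\ [/\ xi 0%N = a, xi p.+1 = b &
          forall j : nat, (j <= p)%N -> xi j < xi j.+1],
      [bounded f x | x in `[a, b]],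
      forall j : nat, (j <= p)%N ->
        exists g : R -> R,
          [/\ forall x, `]xi j, xi j.+1[%classic x -> g x = f x,
              Cn_on n `[xi j, xi j.+1] g &
              forall x, `[xi j, xi j.+1]%classic x ->
                apply_diffop D `[xi j, xi j.+1] g x = 0] &
      forall j : nat, (j <= p.+1)%N ->
        lim (f0 x @[x --> (xi j)^'+]) != lim (f0 x @[x --> (xi j)^'-])].

Definition PD (R : realType) (a b : R) (n : nat) (D : diffop R n) (p : nat) :
    set (R -> R) :=
  [set f | exists xi : nat -> R, PD_at a b D p xi f].

Definition vanishes_off (R : realType) (a b : R) (p : nat) (xi : nat -> R)
    (f : R -> R) : Prop :=
  forall x, `[a, b]%classic x ->
    (forall j : nat, (j <= p.+1)%N -> x != xi j) -> f x = 0.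

Definition moment (R : realType) (a b : R) (k : nat) (f : R -> R) : R :=
  \int[@lebesgue_measure R]_(x in `[a, b]) (x ^+ k * f x).

(* Extended-real valued, since the supremum may be infinite. *)
Definition sigma_op (R : realType) (a b : R) (n : nat) (D : diffop R n)
    (p : nat) : \bar R :=
  let K := [set k : nat | exists (xi : nat -> R) (f : R -> R),
    [/\ PD_at a b D p xi f, ~ vanishes_off a b p xi f &
        forall i : nat, (i <= k)%N -> moment a b i f = 0]] in
  if K == set0 then 0%E
  else (ereal_sup [set (k%:R)%:E | k in K] + 1)%E.

Definition sigma_family (R : realType) (a b : R) (F : set (R -> R)) : \bar R :=
  ereal_sup [set s | exists (n : nat) (D : diffop R n) (p : nat),
    PD a b D p `<=` F /\ s = sigma_op a b D p].

Definition F2 (R : realType) (a b : R) (n p d : nat) : set (R -> R) :=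
  [set f | exists D : diffop R n,
    [/\ PD a b D p f, alpha D = (d%:Z)%:E &
        (edeg (dcoef D ord_max) < ((p + 2)%:Z)%:E)%E]].

(* Main.v *)
(* Integrating against a polynomial q on each piece gives
   int q D f = int (D^* q) f + boundary terms, where D^* is the formal adjoint;
   since alpha(D) = d, D^* raises degrees by at most d. If m_0, ..., m_N vanish
   for N = (p+2)n + d - 1, then the boundary terms sum to 0 for every q of degree
   at most (p+2)n - 1. Taking q with zeros of order n at all the nodes but xi_i,
   where the order is n - 1, isolates the single boundary term
   +- p_n(xi_i) q^(n-1)(xi_i) (f(xi_i^+) - f(xi_i^-)), so p_n(xi_i) = 0 because
   f jumps there. Then p_n has p + 2 roots, against deg p_n < p + 2. *)

Require Import Defs.
From mathcomp Require Import all_boot all_order all_algebra.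
From mathcomp Require Import all_classical all_reals all_analysis.
From mathcomp Require Import measurable_realfun ring zify.
Import Order.TTheory GRing.Theory Num.Theory.
Import numFieldNormedType.Exports.

Set Implicit Arguments.
Unset Strict Implicit.
Unset Printing Implicit Defensive.

Local Open Scope classical_set_scope.
Local Open Scope ring_scope.

(** * Relative derivatives and the Lagrange concomitant *)

(** At an interior point the closed interval is a neighbourhood, so restricting the punctured filter
    to it changes nothing. *)
Lemma is_derive_rel (R : realType) (c d : R) (g : R -> R) (x : R) :
  x \in `]c, d[ -> derivable_rel `[c, d] g x ->
  is_derive x 1 g (derive_rel `[c, d] g x).
Proof.
move=> xcd; rewrite /derive_rel /derivable_rel.
have -> : within `[c, d] x^' = x^'.
  rewrite /dnbhs /= [RHS]/within [LHS]/within.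
  have nA : nbhs x [set` `[c, d]].
    by apply: filterS (near_in_itvoo xcd) => y; apply: subset_itv_oo_cc.
  apply/funext => P; apply/propext; split=> /= H.
    apply: filterS (filterI nA H) => y [Ay] /= Py yx; exact: Py.
  by apply: filterS H => y Py yx _; exact: Py.
have -> : diffq_rel g x y @[y --> x^'] =
    (h^-1 *: (g (h *: 1 + x) - g x)) @[h --> 0^'].
  apply/funext => P; apply/propext.
  (* Both punctured filters are unfolded so that the translation [y = x + h] moves the limit to
     [0]. *)
  change (nbhs x (fun y => y != x -> P (diffq_rel g x y)) <->
    nbhs (0:R) (fun h : R => h != 0 -> P (h^-1 *: (g (h *: 1 + x) - g x)))).
  have E h : diffq_rel g x (x + h) = h^-1 *: (g (h *: 1 + x) - g x).
    by rewrite /diffq_rel [x + h]addrC addrK mulrC [h *: 1]mulr1.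
  rewrite nbhs_nearE nbhs0P; split; apply: filterS => h /=; rewrite E => H h0; apply: H.
    by rewrite -subr_eq0 addrC addKr.
  by rewrite -subr_eq0 addrC addKr in h0.
by move=> gx; split.
Qed.

(* The Lagrange concomitant of [q * d^k], for the jet [G] of a function. *)
Fixpoint concomitant (R : nzRingType) (k : nat) (q : {poly R})
    (G : nat -> R -> R) (x : R) : R :=
  if k is l.+1 then q.[x] * G l x - concomitant l q^`() G x else 0.

(** Lagrange's identity: the term [q' * G l] of the product rule cancels against the one from the
    induction hypothesis for [q'], so the sum telescopes to its two ends. *)
Lemma is_derive_concomitant (R : realType) (k : nat) (q : {poly R})
    (G : nat -> R -> R) (x : R) :
  (forall l, (l < k)%N -> is_derive x 1 (G l) (G l.+1 x)) ->
  is_derive x 1 (concomitant k q G)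
    (q.[x] * G k x - (-1) ^+ k * q^`(k).[x] * G 0%N x).
Proof.
elim: k q => [|k IH] q dG /=.
  rewrite expr0 mul1r subrr; exact: is_derive_cst.
have dGk := dG k (ltnSn k).
have dB := IH q^`() (fun l lk => dG l (ltnW lk)).
rewrite [X in is_derive x 1 X](_ : _ = horner q * G k - concomitant k q^`() G) //.
apply: is_derive_eq.
rewrite -!derivnS ?derivSn /= -![_ *: _]/(_ * _) exprS; ring.
Qed.

Lemma within_continuous_horner (R : realType) (A : set R) (q : {poly R}) :
  {within A, continuous (horner q)}.
Proof. by apply: continuous_subspaceT => x; exact: continuous_horner. Qed.

Lemma within_continuousM (R : realType) (A : set R) (f g : R -> R) :
  {within A, continuous f} -> {within A, continuous g} ->
  {within A, continuous (f * g)}.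
Proof. by move=> cf cg x; apply: cvgM; [exact: cf|exact: cg]. Qed.

Lemma continuous_concomitant (R : realType) (A : set R) (k : nat)
    (q : {poly R}) (G : nat -> R -> R) :
  (forall l, (l < k)%N -> {within A, continuous (G l)}) ->
  {within A, continuous (concomitant k q G)}.
Proof.
elim: k q => [|k IH] q cG /=; first by move=> x; exact: cvg_cst.
apply: (@within_continuousB _ _ _ _ (horner q * G k) (concomitant k q^`() G)).
  by apply: within_continuousM; [exact: within_continuous_horner|exact: cG].
by apply: IH => l lk; apply: cG; exact: ltnW.
Qed.

Lemma deriv_XsubC_exp_mul (R : comNzRingType) (m : nat) (y : R) (r : {poly R}) :
  (('X - y%:P) ^+ m.+1 * r)^`() =
  ('X - y%:P) ^+ m * (r *+ m.+1 + ('X - y%:P) * r^`()).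
Proof.
rewrite derivM deriv_exp derivXsubC mul1r exprS mulrDr mulrnAr mulrnAl -mulrA.
by congr (_ + _); rewrite mulrCA.
Qed.

(** Only derivatives of the polynomial of order below [m] occur, and a root of order [m] kills them
    all. *)
Lemma concomitant_root (R : comNzRingType) (m : nat) (y : R) (r : {poly R})
    (G : nat -> R -> R) :
  concomitant m (('X - y%:P) ^+ m * r) G y = 0.
Proof.
elim: m r => [//|m IH] r /=.
by rewrite deriv_XsubC_exp_mul IH exprS !hornerE subrr !mul0r subr0.
Qed.

(** One order higher, only the term with the [m]-th derivative of the polynomial survives; at [y]
    that derivative is [m! * r(y)]. *)
Lemma concomitant_root_last (R : comNzRingType) (m : nat) (y : R) (r : {poly R})
    (G : nat -> R -> R) :
  concomitant m.+1 (('X - y%:P) ^+ m * r) G y =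
  (-1) ^+ m * m`!%:R * r.[y] * G 0%N y.
Proof.
elim: m r => [|m IH] r.
  by rewrite /= expr0 !mul1r subr0.
rewrite -[LHS]/(_ - concomitant m.+1 _ G y) deriv_XsubC_exp_mul IH.
rewrite exprS !hornerE subrr hornerMn factS natrM exprS; ring.
Qed.

(** * Integrals over pieces *)

(** The endpoints form a null set, so the arbitrary values of [f] at its jump points affect neither
    integrability nor the integral. *)
Lemma integral_eq_continuous (R : realType) (c d : R) (g h : R -> R) :
  {within `[c, d], continuous g} -> {in `]c, d[, h =1 g} ->
  (@lebesgue_measure R).-integrable `[c, d] (EFin \o h) /\
  \int[@lebesgue_measure R]_(x in `[c, d]) h x =
  \int[@lebesgue_measure R]_(x in `[c, d]) g x.
Proof.
move=> cg hg.
have ig : (@lebesgue_measure R).-integrable `[c, d] (EFin \o g).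
  by apply: continuous_compact_integrable => //; exact: segment_compact.
have mg : measurable_fun `]c, d[ g.
  apply/measurable_EFinP; apply: measurable_funS (measurable_int _ ig) => //.
  exact: subset_itv_oo_cc.
have mh : measurable_fun `]c, d[ h.
  by apply: eq_measurable_fun mg => x; rewrite inE => xcd; rewrite hg.
split; last by rewrite /Rintegral (eq_integral_itv_bounded true false mh mg hg).
apply/integrableP; split.
  by apply/measurable_EFinP; exact: measurable_fun_itv_cc mh.
case/integrableP: ig => _; congr (_ < _)%E.
have mN (k : R -> R) :
    measurable_fun `]c, d[ k -> measurable_fun `]c, d[ (fun x => `|k x|).
  by move=> mk; exact: measurableT_comp.
apply: (eq_integral_itv_bounded true false (mN _ mg) (mN _ mh)) => x xcd /=.
by rewrite hg.
Qed.

Lemma integral_pieces (R : realType) (xi : nat -> R) (h : R -> R) (p : nat) :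
  (forall j, (j <= p)%N -> xi j < xi j.+1) ->
  (forall j, (j <= p)%N ->
    (@lebesgue_measure R).-integrable `[xi j, xi j.+1] (EFin \o h)) ->
  [/\ xi 0%N < xi p.+1,
      (@lebesgue_measure R).-integrable `[xi 0%N, xi p.+1] (EFin \o h) &
  \int[@lebesgue_measure R]_(x in `[xi 0%N, xi p.+1]) h x =
  \sum_(j < p.+1) \int[@lebesgue_measure R]_(x in `[xi j, xi j.+1]) h x].
Proof.
elim: p => [|p IH] lt_xi ih.
  by split; [exact: lt_xi|exact: ih|rewrite big_ord1].
have [lt0 i0 e0] := IH (fun j jp => lt_xi j (leqW jp)) (fun j jp => ih j (leqW jp)).
have lt1 := lt_xi p.+1 (leqnn _).
have i1 := ih p.+1 (leqnn _).
(* The last piece is taken half-open to make the union disjoint. *)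
have eU : `[xi 0%N, xi p.+2]%classic = `[xi 0%N, xi p.+1] `|` `]xi p.+1, xi p.+2].
  by rewrite -itv_bndbnd_setU // bnd_simp ltW.
have disj : [disjoint `[xi 0%N, xi p.+1]%classic & `]xi p.+1, xi p.+2]%classic].
  rewrite disj_set2E; apply/eqP/seteqP; split => // x /=.
  by rewrite !in_itv /= => -[/andP[_ xl] /andP[/lt_geF]]; rewrite xl.
have i1' : (@lebesgue_measure R).-integrable `]xi p.+1, xi p.+2] (EFin \o h).
  by apply: integrableS i1 => //; exact: subset_itv_oc_cc.
have iU : (@lebesgue_measure R).-integrable `[xi 0%N, xi p.+2] (EFin \o h).
  case/integrableP: i0 => m0 f0; case/integrableP: i1' => m1 f1.
  have mU : measurable_fun (`[xi 0%N, xi p.+1] `|` `]xi p.+1, xi p.+2]) (EFin \o h).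
    exact/measurable_funU.
  rewrite eU; apply/integrableP; split => //.
  rewrite ge0_integral_setU //; first by rewrite lte_add_pinfty.
  exact: measurableT_comp.
split => //; first exact: lt_trans lt1.
rewrite big_ord_recr /= -e0 -(Rintegral_itv_obnd_cbnd i1') eU Rintegral_setU //.
by rewrite -eU.
Qed.

(** * Formal adjoint and Green's formula *)

Definition adjoint_diffop (R : realType) (n : nat) (D : diffop R n) (q : {poly R}) :=
  \sum_(j < n.+1) (-1) ^+ j *: (dcoef D j * q)^`(j).

Definition concomitant_diffop (R : realType) (n : nat) (D : diffop R n)
    (q : {poly R}) (G : nat -> R -> R) (x : R) :=
  \sum_(j < n.+1) concomitant j (dcoef D j * q) G x.

(** Summing Lagrange's identity over [j] gives [B' = q * Dg - (D^* q) * g] in the interior, where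
    [Dg = 0]; the fundamental theorem of calculus for [- B] concludes. *)
Lemma Green_formula (R : realType) (c d : R) (n : nat) (D : diffop R n)
    (q : {poly R}) (g : R -> R) :
  c < d -> Cn_on n `[c, d] g ->
  (forall x, `[c, d]%classic x -> apply_diffop D `[c, d] g x = 0) ->
  let B := concomitant_diffop D q (fun k => deriven_rel k `[c, d] g) in
  \int[@lebesgue_measure R]_(x in `[c, d]) ((adjoint_diffop D q).[x] * g x) =
  B c - B d.
Proof.
move=> cd [dg cg] Dg /=.
set G := (fun k => deriven_rel k _ _); set B := concomitant_diffop D q G.
have BE : B = \sum_(j < n.+1) concomitant j (dcoef D j * q) G.
  by apply/funext => y; rewrite fct_sumE.
have cB : {within `[c, d], continuous B}.
  rewrite BE; apply: (big_ind (fun h : R -> R => {within `[c, d], continuous h})).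
  - by move=> x; exact: cvg_cst.
  - by move=> h k ch ck; exact: within_continuousD.
  - move=> j _; apply: continuous_concomitant => l lj; apply: cg.
    by rewrite -ltnS (ltn_trans lj).
have dB x : x \in `]c, d[ -> is_derive x 1 B (- ((adjoint_diffop D q).[x] * g x)).
  move=> xcd.
  have xcd' : `[c, d]%classic x by exact: subset_itv_oo_cc xcd.
  have dG l : (l < n)%N -> is_derive x 1 (G l) (G l.+1 x).
    by move=> ln; apply: is_derive_rel => //; exact: dg.
  rewrite BE.
  have dj (j : 'I_n.+1) := is_derive_concomitant (dcoef D j * q)
    (fun l (lj : (l < j)%N) => dG l (leq_trans lj (ltn_ord j))).
  apply: is_derive_eq.
  rewrite sumrB /adjoint_diffop horner_sum mulr_suml.
  rewrite [X in X - _](_ : _ = q.[x] * apply_diffop D `[c, d] g x); last first.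
    rewrite /apply_diffop mulr_sumr; apply: eq_bigr => j _.
    by rewrite hornerM mulrA [q.[x] * _]mulrC.
  rewrite Dg // mulr0 sub0r; congr (- _); apply: eq_bigr => j _.
  by rewrite hornerZ.
have dNB x : x \in `]c, d[ -> is_derive x 1 (- B) ((adjoint_diffop D q).[x] * g x).
  by move=> xcd; have dBx := dB x xcd; apply: is_derive_eq; rewrite opprK.
have LR : derivable_oo_LRcontinuous (- B) c d.
  have [_ cBc cBd] := (continuous_within_itvP _ cd).1 cB.
  split; [by move=> x /dNB[]|exact: cvgN|exact: cvgN].
have cf : {within `[c, d], continuous (horner (adjoint_diffop D q) * g)}.
  by apply: within_continuousM; [exact: within_continuous_horner|exact: (cg 0%N)].
rewrite /Rintegral (continuous_FTC2 cd cf LR) => [|x xcd].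
  by rewrite /= opprK addrC.
by rewrite derive1E; have [_] := dNB x xcd.
Qed.

(** The order of [D] is [n.+1], so a root of order [n] annihilates every term except that of the
    leading coefficient. *)
Lemma concomitant_diffop_root (R : realType) (n : nat) (D : diffop R n.+1) (y : R)
    (r : {poly R}) (G : nat -> R -> R) :
  concomitant_diffop D (('X - y%:P) ^+ n * r) G y =
  (-1) ^+ n * n`!%:R * (dcoef D ord_max * r).[y] * G 0%N y.
Proof.
rewrite /concomitant_diffop big_ord_recr -[LHS]/(_ + _) big1 ?add0r => [|j _].
  by rewrite mulrCA concomitant_root_last.
(* For [j <= n], the factor of exponent [n] is split as [j + (n - j)] to exhibit a root of order
   [j]. *)
by rewrite mulrCA /= -[in ('X - _) ^+ _](subnKC (leq_ord j)) exprD -mulrA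
  concomitant_root.
Qed.

(** * Degree bounds, moments and one-sided limits *)

Lemma size_derivn_leq (R : realType) (j : nat) (q : {poly R}) :
  (size q^`(j) <= size q - j)%N.
Proof.
elim: j => [|j IH]; first by rewrite subn0.
rewrite derivnS; have [->|q0] := eqVneq q^`(j) 0; first by rewrite deriv0 size_poly0.
by have := lt_size_deriv q0; lia.
Qed.

(** Multiplying by [p_j] and differentiating [j] times raises the degree by at most [deg p_j - j],
    hence by at most [d]. *)
Lemma size_adjoint_diffop (R : realType) (n d : nat) (D : diffop R n) (q : {poly R}) :
  (alpha D <= (d%:Z)%:E)%E -> (size (adjoint_diffop D q) <= size q + d)%N.
Proof.
move=> aD; rewrite /adjoint_diffop.
apply: (leq_trans (size_sum _ _ _)); apply/bigmax_leqP => j _.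
apply: (leq_trans (size_scale_leq _ _)); apply: (leq_trans (size_derivn_leq _ _)).
have : ((edeg (dcoef D j) - (j%:Z)%:E)%E <= (d%:Z)%:E)%E.
  by apply: le_trans aD; exact: (le_bigmax _ (fun j => edeg (dcoef D j) - (j%:Z)%:E)%E).
rewrite /edeg; have [->|p0] := eqVneq (dcoef D j) 0.
  by rewrite mul0r size_poly0 sub0n.
rewrite -EFinB lee_fin => h.
have := size_polyMleq (dcoef D j) q; rewrite -size_poly_gt0 in p0.
move: h p0; set s := size (dcoef D j); set t := size (dcoef D j * q).
lia.
Qed.

Lemma integral_poly_moments (R : realType) (a b : R) (f : R -> R) (q : {poly R}) :
  (forall i, (@lebesgue_measure R).-integrable `[a, b]
    (EFin \o (fun x => x ^+ i * f x))) ->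
  \int[@lebesgue_measure R]_(x in `[a, b]) (q.[x] * f x) =
  \sum_(i < size q) q`_i * moment a b i f.
Proof.
move=> intf.
under eq_Rintegral do rewrite horner_coef mulr_suml.
have intcf i : (@lebesgue_measure R).-integrable `[a, b]
    (EFin \o (fun x => q`_i * x ^+ i * f x)).
  have := @integrableZl _ _ R (@lebesgue_measure R) _ (measurable_itv `[a, b])
    q`_i _ (intf i).
  apply: eq_integrable => //= x _; by rewrite -EFinM mulrA.
elim: (size q) => [|k IH].
  rewrite big_ord0; under eq_Rintegral do rewrite big_ord0.
  by rewrite /Rintegral integral0.
rewrite big_ord_recr /= -IH.
rewrite (_ : (fun x => _) = (fun x =>
  \sum_(i < k) q`_i * x ^+ i * f x + q`_k * x ^+ k * f x)); last first.
  by apply/funext => x; rewrite big_ord_recr.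
rewrite RintegralD //; last first.
  have := @integrable_sum _ _ R (@lebesgue_measure R) _ (measurable_itv `[a, b])
    _ (index_enum 'I_k) xpredT
    (fun i : 'I_k => EFin \o (fun x => q`_i * x ^+ i * f x))
    (fun i _ => intcf i).
  by apply: eq_integrable => //= x _; rewrite /= sumEFin.
congr (_ + _); rewrite /moment -RintegralZl //.
by apply: eq_Rintegral => x _; rewrite mulrA.
Qed.

Lemma cvg_piece (R : realType) (c d : R) (f g : R -> R) :
  c < d -> {within `[c, d], continuous g} ->
  (forall x, `]c, d[%classic x -> f x = g x) ->
  f x @[x --> c^'+] --> g c /\ f x @[x --> d^'-] --> g d.
Proof.
move=> cd /(continuous_within_itvP _ cd)[_ gc gd] fg.
split; [apply: cvg_trans gc|apply: cvg_trans gd]; apply: near_eq_cvg;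
  near=> x; apply: esym; apply: fg; rewrite /= in_itv /=; apply/andP; split => //.
Unshelve. all: by end_near. Qed.

(** * Polynomials with prescribed zeros at the nodes *)

(** The boolean [k != i] counts as 0 or 1: the zero has order [n] at node [i] and [n.+1] at the
    others, for an operator of order [n.+1]. *)
Definition node_poly (R : realType) (n m : nat) (xi : nat -> R) (i : 'I_m) : {poly R} :=
  \prod_(k < m) ('X - (xi k)%:P) ^+ (n + (k != i)).

(** The degree is [m * n.+1 - 1], the factor at node [i] being short by one; the size adds it
    back. *)
Lemma size_node_poly (R : realType) (n m : nat) (xi : nat -> R) (i : 'I_m) :
  size (node_poly n xi i) = (m * n.+1)%N.
Proof.
rewrite /node_poly size_prod; last first.
  by move=> k _; rewrite expf_neq0 // polyXsubC_eq0.
under eq_bigr do rewrite size_exp_XsubC.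
rewrite card_ord (bigD1 i) //= eqxx addn0.
rewrite (eq_bigr (fun=> n.+2)) => [|k ->]; last by rewrite addn1.
rewrite sum_nat_const cardC1 card_ord; have := ltn_ord i.
case: m i => // m _ _ /=; nia.
Qed.

(** Away from [i] a spare linear factor remains in [r]; at [i] none does, and distinctness of the
    nodes keeps [r] nonzero there. *)
Lemma node_poly_factor (R : realType) (n m : nat) (xi : nat -> R) (i k : 'I_m) :
  {in [pred j | (j < m)%N] &, injective xi} ->
  exists r : {poly R}, node_poly n xi i = ('X - (xi k)%:P) ^+ n * r /\
    (r.[xi k] == 0) = (k != i).
Proof.
move=> inj_xi.
exists (('X - (xi k)%:P) ^+ (k != i) *
  \prod_(j < m | j != k) ('X - (xi j)%:P) ^+ (n + (j != i))).
split; first by rewrite /node_poly (bigD1 k) //= exprD mulrA.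
rewrite hornerM mulf_eq0 horner_exp hornerXsubC subrr.
have /negPf -> : (\prod_(j < m | j != k) ('X - (xi j)%:P) ^+ (n + (j != i))).[xi k] != 0.
  rewrite horner_prod; apply/prodf_neq0 => j jk.
  rewrite horner_exp hornerXsubC expf_neq0 // subr_eq0.
  by apply: contra jk => /eqP/inj_xi; rewrite !inE !ltn_ord
    => /(_ isT isT)/val_inj->.
by rewrite orbF; case: (k != i); rewrite ?expr1 ?expr0 ?eqxx ?oner_eq0.
Qed.

Lemma nodes_increasing (R : realType) (p : nat) (xi : nat -> R) :
  (forall j : nat, (j <= p)%N -> xi j < xi j.+1) ->
  forall i j, (i < j <= p.+1)%N -> xi i < xi j.
Proof.
move=> lt_xi i; elim=> [//|j IH] /andP[]; rewrite ltnS leq_eqVlt => /predU1P[->|ij] jp.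
  exact: lt_xi.
by apply: lt_trans (lt_xi j _) => //; apply: IH; rewrite ij ltnW.
Qed.

(** With its mirror image at [a], this lets the boundary sums over pieces be completed to sums over
    all nodes. *)
Lemma lim_patch_right (R : realType) (a b : R) (f : R -> R) :
  lim (patch (fun=> 0) `[a, b] f x @[x --> b^'+]) = 0.
Proof.
apply: cvg_lim => //; apply: cvg_near_cst; near=> x.
rewrite patchE ifF //; apply/negbTE/negP; rewrite inE /= in_itv /= => /andP[_].
by apply/negP; rewrite -ltNge; near: x; exact: nbhs_right_gt.
Unshelve. all: by end_near. Qed.

Lemma lim_patch_left (R : realType) (a b : R) (f : R -> R) :
  lim (patch (fun=> 0) `[a, b] f x @[x --> a^'-]) = 0.
Proof.
apply: cvg_lim => //; apply: cvg_near_cst; near=> x.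
rewrite patchE ifF //; apply/negbTE/negP; rewrite inE /= in_itv /= => /andP[+ _].
by apply/negP; rewrite -ltNge; near: x; exact: nbhs_left_lt.
Unshelve. all: by end_near. Qed.

(** * Bound on the number of vanishing moments *)

Lemma PD_moments_not_all0 (R : realType) (a b : R) (n p d : nat) (D : diffop R n.+1)
    (xi : nat -> R) (f : R -> R) :
  PD_at a b D p xi f -> (alpha D <= (d%:Z)%:E)%E ->
  (edeg (dcoef D ord_max) < (p.+2%:Z)%:E)%E ->
  ~ (forall i : nat, (i < p.+2 * n.+1 + d)%N -> moment a b i f = 0).
Proof.
move=> [[xia xib lt_xi] _ pieces jumps] aD degD mom0.
set f0 := patch _ _ _ in jumps.
pose L k := lim (f0 x @[x --> (xi k)^'-]).
pose Rt k := lim (f0 x @[x --> (xi k)^'+]).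
have lt_nodes := nodes_increasing lt_xi.
have inj_xi : {in [pred j | (j < p.+2)%N] &, injective xi}.
  move=> i j; rewrite !inE !ltnS => ip jp e; case: (ltngtP i j) => // ij.
    by have := lt_nodes i j; rewrite ij jp e ltxx => /(_ isT).
  by have := lt_nodes j i; rewrite ij ip e ltxx => /(_ isT).
have sub_ab j : (j <= p)%N -> `]xi j, xi j.+1[ `<=` `[a, b].
  move=> jp x; rewrite /= !in_itv /= => /andP[ax xb].
  have aj : a <= xi j.
    rewrite -xia; case: j jp {ax xb} => [|j] jp; first exact: lexx.
    by apply/ltW/lt_nodes/leqW.
  have jb : xi j.+1 <= b.
    rewrite -xib; move: jp; rewrite leq_eqVlt => /predU1P[->//|jp].
    by rewrite ltW // lt_nodes // ltnS jp leqnn.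
  by rewrite (le_trans aj (ltW ax)) (le_trans (ltW xb) jb).
have piece_int (h : R -> R) j : continuous h -> (j <= p)%N ->
    (@lebesgue_measure R).-integrable `[xi j, xi j.+1] (EFin \o (fun x => h x * f x)).
  move=> ch jp; have [g [fg [_ cg] _]] := pieces j jp.
  apply: (proj1 (integral_eq_continuous (g := h * g) _ _)).
    apply: within_continuousM; last exact: (cg 0%N).
    exact: continuous_subspaceT.
  by move=> x xj; rewrite -fg.
have intf i : (@lebesgue_measure R).-integrable `[a, b] (EFin \o (fun x => x ^+ i * f x)).
  rewrite -xia -xib; have [] // := @integral_pieces _ xi (fun x => x ^+ i * f x) p lt_xi.
  by move=> j jp; apply: piece_int => // x; exact: exprn_continuous.
(* [r0] and [r1] are the cofactors of [q] at the two ends of the piece; each end leaves one boundary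
   term, in which the value of [g] is a one-sided limit of [f]. *)
have piece_Green (i : 'I_p.+2) (q := node_poly n xi i) j (r0 r1 : {poly R}) :
    (j <= p)%N ->
    q = ('X - (xi j)%:P) ^+ n * r0 -> q = ('X - (xi j.+1)%:P) ^+ n * r1 ->
    \int[@lebesgue_measure R]_(x in `[xi j, xi j.+1]) ((adjoint_diffop D q).[x] * f x) =
    (-1) ^+ n * n`!%:R *
    ((dcoef D ord_max * r0).[xi j] * Rt j - (dcoef D ord_max * r1).[xi j.+1] * L j.+1).
  move=> jp q0 q1; have [g [fg Cg Dg]] := pieces j jp; have [_ cg] := Cg.
  have [gR gL] : Rt j = g (xi j) /\ L j.+1 = g (xi j.+1).
    have f0g x : `]xi j, xi j.+1[%classic x -> f0 x = g x.
      by move=> xj; rewrite fg // /f0 patchE ifT // inE; exact: (sub_ab j).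
    have [cR cL] := cvg_piece (lt_xi j jp) (cg 0%N (leq0n _)) f0g.
    by split; exact: cvg_lim.
  rewrite (proj2 (integral_eq_continuous
    (g := fun x => (adjoint_diffop D q).[x] * g x) _ _)).
  - rewrite (Green_formula _ (lt_xi j jp) Cg Dg).
    by rewrite {1}q0 q1 !concomitant_diffop_root /= gR gL mulrBr !mulrA.
  - apply: within_continuousM; last exact: (cg 0%N).
    exact: within_continuous_horner.
  - by move=> x xj; rewrite -fg.
(* With all [p.+2] distinct nodes as roots, the leading coefficient would have degree at least
   [p.+2]. *)
suff root_xi (i : 'I_p.+2) : root (dcoef D ord_max) (xi i).
  have pn0 : dcoef D ord_max != 0 by case: (D).
  have := @max_poly_roots _ _ (map xi (iota 0 p.+2)) pn0.
  rewrite size_map size_iota => sz; move: degD; rewrite /edeg (negPf pn0) lte_fin => degD.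
  have : (p.+2 < size (dcoef D ord_max))%N.
    apply: sz.
      apply/allP => _ /mapP[i + ->]; rewrite mem_iota => /andP[_ ip].
      exact: (root_xi (Ordinal ip)).
    rewrite map_inj_in_uniq ?iota_uniq // => i j; rewrite !mem_iota => ip jp.
    exact: inj_xi.
  by move: degD; lia.
have fac (k : 'I_p.+2) := node_poly_factor n i k inj_xi.
pose q := node_poly n xi i.
pose r (k : 'I_p.+2) := projT1 (cid (fac k)).
have rP (k : 'I_p.+2) : q = ('X - (xi k)%:P) ^+ n * r k by case: (projT2 (cid (fac k))).
have r0 (k : 'I_p.+2) : ((r k).[xi k] == 0) = (k != i) by case: (projT2 (cid (fac k))).
(* The cofactors are indexed by ordinals; extending by 0 to all naturals allows the indices [j] and
   [j.+1] in sums over pieces. *)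
pose C k := if insub k is Some k' then (dcoef D ord_max * r k').[xi k] else 0.
have CE (k : 'I_p.+2) : C k = (dcoef D ord_max * r k).[xi k] by rewrite /C valK.
have C0 (k : 'I_p.+2) : k != i -> C k = 0.
  by rewrite -r0 CE hornerM => /eqP->; rewrite mulr0.
(* The size of [D^* q] is at most [p.+2 * n.+1 + d], exactly the number of moments assumed to
   vanish. *)
have : \int[@lebesgue_measure R]_(x in `[a, b]) ((adjoint_diffop D q).[x] * f x) = 0.
  rewrite integral_poly_moments // big1 // => k _; rewrite mom0 ?mulr0 //.
  apply: (leq_trans (ltn_ord k)); apply: (leq_trans (size_adjoint_diffop _ aD)).
  by rewrite /q size_node_poly.
rewrite -xia -xib.
have [_ _ ->] := integral_pieces (h := fun x => (adjoint_diffop D q).[x] * f x)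
  lt_xi (fun j jp => piece_int _ j (@continuous_horner _ _) jp).
have -> : \sum_(j < p.+1) \int[@lebesgue_measure R]_(x in `[xi j, xi j.+1])
    ((adjoint_diffop D q).[x] * f x) =
    (-1) ^+ n * n`!%:R * (\sum_(j < p.+1) C j * Rt j - \sum_(j < p.+1) C j.+1 * L j.+1).
  rewrite -sumrB mulr_sumr; apply: eq_bigr => j _.
  have := CE (lift ord0 j); have := CE (widen_ord (leqnSn _) j).
  rewrite /= /bump /= add1n => -> ->.
  apply: piece_Green; first exact: leq_ord.
    exact: (rP (widen_ord _ j)).
  exact: (rP (lift ord0 j)).
have sumC (h : nat -> R) : \sum_(k < p.+2) C k * h k = C i * h i.
  by rewrite (bigD1 i) //= big1 ?addr0 // => k ki; rewrite C0 ?mul0r.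
have -> : \sum_(j < p.+1) C j * Rt j = C i * Rt i.
  by rewrite -sumC [RHS]big_ord_recr /= /Rt xib lim_patch_right mulr0 addr0.
have -> : \sum_(j < p.+1) C j.+1 * L j.+1 = C i * L i.
  by rewrite -sumC [RHS]big_ord_recl /= /L xia lim_patch_left mulr0 add0r.
(* The sign, the factorial and the jump at node [i] are nonzero, so [C i = 0]; as [r i] does not
   vanish there, the leading coefficient does. *)
rewrite -mulrBr => /eqP; rewrite !mulf_eq0 signr_eq0 pnatr_eq0 eqn0Ngt fact_gt0 /=.
rewrite subr_eq0 (negPf (jumps i _)) ?leq_ord // orbF.
by rewrite CE hornerM mulf_eq0 r0 eqxx orbF.
Qed.

Theorem corollary4 (R : realType) (a b : R) (n p d : nat) :
  a < b -> (0 < n)%N -> (0 < d)%N ->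
  (sigma_family a b (F2 a b n p d) <= (((p + 2) * n + d - 1)%N%:R)%:E)%E.
Proof.
move=> ab; case: n => // n _ d0.
apply: ge_ereal_sup => _ [n' [D' [p' [subF ->]]]].
rewrite /sigma_op; case: ifPn => _; first by rewrite lee_fin.
(* The [+ 1] in the index is moved to the right: each admissible [k] must satisfy
   [k + 1 <= (p + 2) * n.+1 + d - 1]. *)
rewrite -leeBrDr //; apply: ge_ereal_sup => _ [k [xi [f [PDf _ mom0]]] <-].
rewrite -EFinB lee_fin lerBrDr natr1 ler_nat ltnNge; apply/negP => kN.
(* [D'] may have another order and another number of jumps; membership in the family supplies an
   operator [D] and nodes [xi'] of the prescribed type for the same [f]. *)
have [D [[xi' PDf'] aD degD]] : F2 a b n.+1 p d f by apply: subF; exists xi.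
rewrite addn2 in degD kN.
apply: (PD_moments_not_all0 PDf' _ degD) => [|i iN].
  by rewrite aD.
by apply: mom0; lia.
Qed.
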